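(* Let $m,N\ge 1$, $X=Y=\mathbb{R}^m$, $\Gamma=[-1,1]^N$, let $D\subset\mathbb{R}^m$ be open and convex, let $\mathbf f:D\times\Gamma\to\mathbb{R}^m$, $(\mathbf x,\mathbf q)\mapsto \mathbf f(\mathbf x,\mathbf q)$, be Fréchet differentiable in $\mathbf x$ with Jacobian $\mathbf J(\mathbf x,\mathbf q)=\partial_{\mathbf x}\mathbf f(\mathbf x,\mathbf q)$, and let $\Psi\subset\mathbb{C}^N$ be a domain with $\Gamma\subset\Psi$. Let $\mathbf x^0\in D_0$, let $D_v\subset D$ and $\Theta_v\subset\mathbb{C}^m$, $D_v\subset\Theta_v$ ($v\in\mathbb{N}_0$) be the domains of the real and of the complexified Newton iteration, as described in the context. Assume that for all $v\in\mathbb{N}_0$: (i) $\mathbf f$ restricted to $D_v\times\Gamma$ can be analytically extended to a function $\mathbf f^v$ on $\Theta_v\times\Psi$; let $\mathbf J^v$ denote the corresponding analytic extension to $\Theta_v\times\Psi$ of $\mathbf J$ restricted to $D_v\times\Gamma$. (ii) There exists a constant $c_v>0$ such that, on $\Theta_v\times\Psi$, $$\sigma_{\min}\left(\begin{bmatrix}\mathbf J^v_R & -\mathbf J^v_I\\ \mathbf J^v_I & \mathbf J^v_R\end{bmatrix}\right)\ge c_v ,$$ where $\sigma_{\min}$ is the minimum singular value, $\mathbf J^v_R=\operatorname{Re}\mathbf J^v$ and $\mathbf J^v_I=\operatorname{Im}\mathbf J^v$. Then for all $v\in\mathbb{N}_0$ there exists an analytic extension to $\Psi$ of the $v$-th Newton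 iterate $\mathbf x^v$, viewed as a function $\mathbf q\mapsto\mathbf x^v(\mathbf q)$ on $\Gamma$.
   Context: $\mathbb{N}_0=\mathbb{N}\cup\{0\}$. A domain is a nonempty connected open set. Analytic extension: a function $\mathbf h^*$ on a complex domain (an open connected subset of some $\mathbb{C}^k$) containing a real set $S\subset\mathbb{R}^k$ is an analytic extension of a function $\mathbf h$ on $S$ if $\mathbf h^*$ is (jointly) complex analytic on its domain and $\mathbf h^*|_S=\mathbf h$. Real Newton iteration: for $\mathbf q\in\Gamma$, $\mathbf x^0$ is fixed (independent of $\mathbf q$) and $$\mathbf x^{v+1}(\mathbf q)=\mathbf x^{v}(\mathbf q)-\mathbf J(\mathbf x^{v}(\mathbf q),\mathbf q)^{-1}\mathbf f(\mathbf x^{v}(\mathbf q),\mathbf q),\qquad v\in\mathbb{N}_0 .$$ The sets $D_v\subset D\subset\mathbb{R}^m$ are such that $\mathbf x^0\in D_0$ and, for each $\mathbf q\in\Gamma$, the map $\mathbf x\mapsto \mathbf x-\mathbf J(\mathbf x,\mathbf q)^{-1}\mathbf f(\mathbf x,\mathbf q)$ sends $D_{v}$ into $D_{v+1}$. Complexified Newton iteration: for $\mathbf g\in\Psi$, $\mathbf z^0=\mathbf x^0$ and $\mathbf z^{v+1}=\mathbf z^{v}-\mathbf J^{v}(\mathbf z^{v},\mathbf g)^{-1}\mathbf f^{v}(\mathbf z^{v},\mathbf g)$. The sets $\Theta_v\subset\mathbb{C}^m$ are domains with $D_v\subset\Theta_v$ such that, for each $\mathbf g\in\Psi$, the map $\mathbf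 z\mapsto\mathbf z-\mathbf J^{v}(\mathbf z,\mathbf g)^{-1}\mathbf f^{v}(\mathbf z,\mathbf g)$ sends $\Theta_{v}$ into $\Theta_{v+1}$. *)

(* Defs.v *)
From HB Require Import structures.
From mathcomp Require Import all_boot all_order all_algebra.
From mathcomp Require Import finmap.
From mathcomp Require Import complex.
From mathcomp Require Import all_classical all_reals all_analysis.
From mathcomp.analysis.showcase Require Import summability.

Set Implicit Arguments.
Unset Strict Implicit.
Unset Printing Implicit Defensive.

Import Order.TTheory GRing.Theory Num.Theory.
Import numFieldNormedType.Exports.

Local Open Scope classical_set_scope.
Local Open Scope ring_scope.

(* The topology of R[i] is that of its modulus, as for any numFieldType; this
   only makes it available by inference on R[i] and on matrices over R[i].   *)
HB.instance Definition _ (R : realType) := NormedModule.copy R[i] R[i]^o.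

Definition cplx (R : realType) p n (A : 'M[R]_(p, n)) : 'M[R[i]]_(p, n) :=
  map_mx (real_complex R) A.

Definition is_domain (T : topologicalType) (U : set T) : Prop :=
  [/\ U !=set0, connected U & open U].

Definition power_series_term (R : realType) k
    (c : {ffun 'I_k -> nat} -> R[i]) (a z : 'cV[R[i]]_k)
    (alpha : {ffun 'I_k -> nat}) : R[i] :=
  c alpha * \prod_(i < k) (z i 0 - a i 0) ^+ alpha i.

(* F is, on a neighbourhood of a, the sum of a power series
   \sum_alpha c_alpha (z - a)^alpha indexed by the multi-indices alpha in N^k.
   The sum is that of a summable family: convergence along the finite sets of
   multi-indices ordered by inclusion, i.e. unconditional convergence.       *)
Definition analytic_at (R : realType) k (F : 'cV[R[i]]_k -> R[i])
    (a : 'cV[R[i]]_k) : Prop :=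
  exists c : {ffun 'I_k -> nat} -> R[i],
    \forall z \near a,
      partial_sum (power_series_term c a z) @ totally --> F z.

Definition analytic_on (R : realType) k p n (U : set 'cV[R[i]]_k)
    (F : 'cV[R[i]]_k -> 'M[R[i]]_(p, n)) : Prop :=
  forall a, U a -> forall i j, analytic_at (fun z => F z i j) a.

(* H, on the complex domain U, extends the restriction of h to S. *)
Definition analytic_extension (R : realType) k p n
    (S : set 'cV[R]_k) (h : 'cV[R]_k -> 'M[R]_(p, n))
    (U : set 'cV[R[i]]_k) (H : 'cV[R[i]]_k -> 'M[R[i]]_(p, n)) : Prop :=
  [/\ is_domain U, [set cplx x | x in S] `<=` U, analytic_on U H
    & forall x, S x -> H (cplx x) = cplx (h x)].

(* K^m x K^N is identified with K^(m + N) by stacking columns. *)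
Definition prod_set (K : Type) m N (A : set 'cV[K]_m) (B : set 'cV[K]_N) :
    set 'cV[K]_(m + N) :=
  [set w | A (usubmx w) /\ B (dsubmx w)].

Definition joint (K T : Type) m N (F : 'cV[K]_m -> 'cV[K]_N -> T)
    (w : 'cV[K]_(m + N)) : T :=
  F (usubmx w) (dsubmx w).

Definition cube (R : realType) N : set 'cV[R]_N :=
  [set q | forall i, -1 <= q i 0 <= 1].

Definition jacobian_x (R : realType) m N
    (f : 'cV[R]_m -> 'cV[R]_N -> 'cV[R]_m)
    (x : 'cV[R]_m) (q : 'cV[R]_N) : 'M[R]_m :=
  \matrix_(i, j) ('d (f^~ q) x (delta_mx j 0)) i 0.

(* invmx is the identity on singular matrices; in the theorem J is invertible
   wherever this map is used.                                               *)
Definition newton_map (K : fieldType) m N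
    (f : 'cV[K]_m -> 'cV[K]_N -> 'cV[K]_m)
    (J : 'cV[K]_m -> 'cV[K]_N -> 'M[K]_m)
    (x : 'cV[K]_m) (q : 'cV[K]_N) : 'cV[K]_m :=
  x - invmx (J x q) *m f x q.

Fixpoint newton_iter (K : fieldType) m N
    (f : 'cV[K]_m -> 'cV[K]_N -> 'cV[K]_m)
    (J : 'cV[K]_m -> 'cV[K]_N -> 'M[K]_m)
    (x0 : 'cV[K]_m) (v : nat) (q : 'cV[K]_N) : 'cV[K]_m :=
  if v is v'.+1 then newton_map f J (newton_iter f J x0 v' q) q else x0.

Definition realify (R : realType) m (A : 'M[R[i]]_m) : 'M[R]_(m + m) :=
  let AR := map_mx (@complex.Re R) A in
  let AI := map_mx (@complex.Im R) A in
  block_mx AR (- AI) AI AR.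

Definition singular_value (R : realType) n (A : 'M[R]_n) (s : R) : Prop :=
  0 <= s /\ eigenvalue (A^T *m A) (s ^+ 2).

(* The set of singular values is finite, and nonempty for n >= 1. *)
Definition sigma_min (R : realType) n (A : 'M[R]_n) : R :=
  inf [set s | singular_value A s].

(* Main.v *)
Require Import Defs.
From HB Require Import structures.
From mathcomp Require Import all_boot all_order all_algebra.
From mathcomp Require Import finmap.
From mathcomp Require Import complex.
From mathcomp Require Import all_classical all_reals all_analysis.
From mathcomp.analysis.showcase Require Import summability.

Set Implicit Arguments.
Unset Strict Implicit.
Unset Printing Implicit Defensive.

Import Order.TTheory GRing.Theory Num.Theory.
Import numFieldNormedType.Exports.

Local Open Scope classical_set_scope.
Local Open Scope ring_scope.

(** Say that [F] expands at [a] with radius [r] and norm [M] when it is, on the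
    closed polydisc of radius [r], the sum of a power series whose coefficients
    satisfy [\sum_alpha |c_alpha| r ^ |alpha| <= M].  For fixed [a] and [r] this
    is the weighted l1 Banach algebra, and rearranging an absolutely summable
    double family shows that a norm-summable family of such functions has a sum
    of the same kind.  Products, compositions and the geometric series are all
    obtained from this single fact: if [G - G a] has norm at most the radius of
    [F] at [G a], then [F \o G] is a norm-summable combination of monomials in
    the [G_i - G_i a], and this smallness holds after shrinking [r].
    An unconditionally convergent complex series converges absolutely, so that
    analyticity at [a] means having an expansion for some [r > 0].

    The bound on the least singular value makes [J^v] invertible on
    [Theta_v x Psi], hence [J^v]^-1 = adj / det is analytic, and the
    complexified Newton iterates [g |-> z^v(g)] are analytic on [Psi] by
    induction on [v]; they agree with the real ones on the cube. *)

(** * Unconditional sums of complex families and absolute convergence *)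

Section UnconditionalSums.
Variable R : realType.
Local Notation C := R[i].

Definition sums_to (I : choiceType) (u : I -> C) (s : C) : Prop :=
  partial_sum u @ totally --> s.

(** The empty set gives [0 <= M] in the order of [R[i]], so the complex number [M] is automatically
    a nonnegative real. *)
Definition abs_bounded (I : choiceType) (u : I -> C) (M : C) : Prop :=
  forall A : {fset I}, \sum_(i <- A) `|u i| <= M.

Lemma partial_sumE (V : zmodType) (I : choiceType) (u : I -> V) (A : {fset I}) :
  partial_sum u A = \sum_(i <- A) u i.
Proof. by rewrite /partial_sum big_seq_fsetE. Qed.

Lemma near_totally_sup (I : choiceType) (A : {fset I}) :
  \forall B \near totally, (A `<=` B)%fset.
Proof. by exists A. Qed.

Lemma near_totallyP (I : choiceType) (P : set {fset I}) :
  (\forall B \near totally, P B) ->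
  exists A, forall B : {fset I}, (A `<=` B)%fset -> P B.
Proof. by case=> A _ AP; exists A => B; apply: AP. Qed.

Lemma sums_toP (I : choiceType) (u : I -> C) (s : C) :
  sums_to u s <-> forall e : C, 0 < e -> exists A : {fset I},
    forall B : {fset I}, (A `<=` B)%fset -> `|s - \sum_(i <- B) u i| <= e.
Proof.
have FF := @totally_filter I.
split=> [/cvgrPdist_le us e /us/near_totallyP[A AP]|us].
  by exists A => B /AP; rewrite partial_sumE.
apply/cvgrPdist_le => e /us[A AP].
exists A => // B AB; rewrite partial_sumE; exact: AP.
Qed.

Lemma norm_Re_le (z : C) : `|'Re z| <= `|z|.
Proof.
rewrite ReE normrM [X in _ * X]ger0_norm ?invr_ge0 // ler_pdivrMr //.
by rewrite (le_trans (ler_normD _ _)) // norm_conjC mulr_natr mulr2n.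
Qed.

Lemma sums_to_unique (I : choiceType) (u : I -> C) (s t : C) :
  sums_to u s -> sums_to u t -> s = t.
Proof.
have FF := @totally_filter I.
by move=> us ut; apply: (cvg_unique (@norm_hausdorff _ C) us ut).
Qed.

Lemma cvg_norm_le (T : Type) (F : set_system T) (FF : ProperFilter F)
    (h : T -> C) (l M : C) :
  h x @[x --> F] --> l -> (\forall x \near F, `|h x| <= M) -> `|l| <= M.
Proof.
move=> /cvgrPdist_le hl hM; apply/ler_addgt0Pr => e e0.
have [x [hx hx']] : exists x, `|l - h x| <= e /\ `|h x| <= M.
  have : \forall x \near F, `|l - h x| <= e /\ `|h x| <= M.
    by apply: filterI => //; exact: hl.
  exact: filter_ex.
rewrite -[l](subrK (h x)) (le_trans (ler_normD _ _)) // addrC lerD //.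
Qed.

Lemma sums_to_norm_le (I : choiceType) (u : I -> C) (s M : C) :
  sums_to u s -> abs_bounded u M -> `|s| <= M.
Proof.
move=> us uM; have FF := @totally_filter I.
apply: (@cvg_norm_le _ _ FF (partial_sum u) s M us); apply: nearW => A.
by rewrite partial_sumE (le_trans (ler_norm_sum _ _ _)).
Qed.

Lemma sums_to_ext (I : choiceType) (u v : I -> C) (s : C) :
  u =1 v -> sums_to u s -> sums_to v s.
Proof. by move=> /funext ->. Qed.

Lemma sums_toD (I : choiceType) (u v : I -> C) (s t : C) :
  sums_to u s -> sums_to v t -> sums_to (fun i => u i + v i) (s + t).
Proof.
move=> us vt; have FF := @totally_filter I.
rewrite /sums_to.
have -> : partial_sum (fun i => u i + v i) = partial_sum u + partial_sum v.
  by apply/funext => A; rewrite addrfctE !partial_sumE -big_split.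
exact: (@cvgD C C _ _ FF _ _ _ _ us vt).
Qed.

Lemma sums_toZ (I : choiceType) (a : C) (u : I -> C) (s : C) :
  sums_to u s -> sums_to (fun i => a * u i) (a * s).
Proof.
move=> us; have FF := @totally_filter I.
rewrite /sums_to.
have -> : partial_sum (fun i => a * u i) = (fun A => a * partial_sum u A).
  by apply/funext => A; rewrite !partial_sumE mulr_sumr.
exact: (@cvgMl_tmp C _ _ FF _ a _ us).
Qed.

Lemma sums_to_fin_supp (I : choiceType) (u : I -> C) (A : {fset I}) :
  (forall i, i \notin A -> u i = 0) -> sums_to u (\sum_(i <- A) u i).
Proof.
move=> u0; apply/sums_toP => e e0; exists A => B AB.
rewrite (big_fset_incl _ AB) ?subrr ?normr0 ?ltW // => i _; exact: u0.
Qed.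

(** The sum is the supremum of the finite partial sums, since these increase with the index set. *)
Lemma sums_to_real (I : choiceType) (w : I -> R) (M : R) :
  (forall i, 0 <= w i) -> (forall A : {fset I}, \sum_(i <- A) w i <= M) ->
  exists s, sums_to (fun i => (w i)%:C%C) s.
Proof.
move=> w0 wM; pose S := range (fun A : {fset I} => \sum_(i <- A) w i).
have supS : has_sup S.
  split; first by exists (\sum_(i <- fset0) w i); exists fset0.
  by exists M => _ [A _ <-]; exact: wM.
exists (sup S)%:C%C; apply/sums_toP => e e0.
(* A positive element of [R[i]] is real, so the supremum can be approached in [R] within [Re e]. *)
have eE : e = (complex.Re e)%:C%C by rewrite RRe_real // gtr0_real.
have e0' : 0 < complex.Re e by rewrite -ltcR -eE.
have [_ [A _ <-] ltA] := sup_adherent e0' supS.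
exists A => B AB.
rewrite -(big_morph (real_complex R) (rmorphD _) (rmorph0 _)) -rmorphB /=.
have leB : \sum_(i <- B) w i <= sup S by apply: sup_upper_bound => //; exists B.
rewrite ger0_norm; last by rewrite ler0c subr_ge0.
rewrite eE lecR lerBlDr -lerBlDl.
apply: le_trans (ltW ltA) _.
rewrite [leRHS](big_fsetID _ (mem A)) /=.
have -> : [fset x in B | x \in A]%fset = A.
  apply/fsetP => x; rewrite !inE /= andbC; case xA: (x \in A) => //=.
  exact: (fsubsetP AB).
by rewrite lerDl sumr_ge0.
Qed.

(** A real family is [(|w| + w) - |w|], a difference of nonnegative families bounded by [M + M] and
    [M]. *)
Lemma sums_to_Creal (I : choiceType) (w : I -> C) (M : C) :
  (forall i, w i \is Num.real) -> abs_bounded w M -> exists s, sums_to w s.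
Proof.
move=> wr wM.
have pos (v : I -> C) (M' : C) : (forall i, 0 <= v i) -> abs_bounded v M' ->
    exists s, sums_to v s.
  move=> v0 vM.
  have vE i : (complex.Re (v i))%:C%C = v i by rewrite RRe_real // ger0_real.
  have ME : (complex.Re M')%:C%C = M'.
    by have := vM fset0; rewrite big_seq_fset0 => /ger0_real/RRe_real.
  have [||s] := @sums_to_real I (fun i => complex.Re (v i)) (complex.Re M').
  - by move=> i; rewrite -ler0c vE.
  - move=> A; rewrite -lecR ME (big_morph (real_complex R) (rmorphD _) (rmorph0 _)).
    apply: le_trans (vM A); apply: ler_sum => i _.
    by rewrite [X in X <= _]vE ger0_norm.
  by move=> vs; exists s; apply: (sums_to_ext _ vs) => i; rewrite vE.
have [s1 ws1] : exists s, sums_to (fun i => `|w i| + w i) s.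
  apply: (@pos _ (M + M)) => [i|A].
    by rewrite -lerBlDl sub0r lerNl -normrN real_ler_norm ?rpredN.
  apply: le_trans (_ : \sum_(i <- A) (`|w i| + `|w i|) <= _).
    by apply: ler_sum => i _; rewrite (le_trans (ler_normD _ _)) // normr_id.
  by rewrite big_split lerD.
have [s2 ws2] : exists s, sums_to (fun i => `|w i|) s.
  apply: (@pos _ M) => [i|A]; first exact: normr_ge0.
  by under eq_bigr do rewrite normr_id; exact: wM.
exists (s1 + -1 * s2).
apply: (sums_to_ext _ (sums_toD ws1 (sums_toZ (a := -1) ws2))) => i.
by rewrite mulN1r addrAC subrr add0r.
Qed.

(** Real and imaginary parts are dominated by the modulus, hence are real families covered by
    [sums_to_Creal]. *)
Lemma abs_bounded_summable (I : choiceType) (u : I -> C) (M : C) :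
  abs_bounded u M -> exists s, sums_to u s.
Proof.
move=> uM.
have [s1 us1] : exists s, sums_to (fun i => 'Re (u i)) s.
  apply: (@sums_to_Creal _ _ M) => [i|A]; first exact: Creal_Re.
  apply: le_trans (uM A); apply: ler_sum => i _.
  exact: norm_Re_le.
have [s2 us2] : exists s, sums_to (fun i => 'Im (u i)) s.
  apply: (@sums_to_Creal _ _ M) => [i|A]; first exact: Creal_Im.
  apply: le_trans (uM A); apply: ler_sum => i _.
  by rewrite -normrN -ReMil (le_trans (norm_Re_le _)) // normrM normCi mul1r.
exists (s1 + 'i * s2).
apply: (sums_to_ext _ (sums_toD us1 (sums_toZ (a := 'i) us2))) => i.
by rewrite -Crect.
Qed.

(** Over indices where ['Re (u i)] keeps its sign, the sum of its moduli is at most the modulus of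
    one finite sum of [u]; there are two signs. *)
Lemma sum_Re_le (I : choiceType) (u : I -> C) (A : {fset I}) (M : C) :
  (forall B : {fset I}, (B `<=` A)%fset -> `|\sum_(i <- B) u i| <= M) ->
  \sum_(i <- A) `|'Re (u i)| <= M + M.
Proof.
move=> uM; rewrite (big_fsetID _ (fun i => 0 <= 'Re (u i))) /=; apply: lerD.
  rewrite (eq_big_seq (fun i => 'Re (u i))) => [|i]; last first.
    by rewrite !inE => /andP[_ ?]; rewrite ger0_norm.
  rewrite -raddf_sum; apply: le_trans (uM [fset x in A | 0 <= 'Re (u x)]%fset _).
    apply: le_trans (norm_Re_le _); exact/real_ler_norm/Creal_Re.
  by apply/fsubsetP => x; rewrite !inE => /andP[].
rewrite (eq_big_seq (fun i => - 'Re (u i))) => [|i]; last first.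
  rewrite !inE => /andP[_]; rewrite -real_ltNge ?Creal_Re // => ?.
  by rewrite ltr0_norm.
rewrite sumrN -raddf_sum.
apply: le_trans (uM [fset x in A | ~~ (0 <= 'Re (u x))]%fset _).
  apply: le_trans (norm_Re_le _); rewrite -normrN.
  by apply/real_ler_norm; rewrite rpredN Creal_Re.
by apply/fsubsetP => x; rewrite !inE => /andP[].
Qed.

(* Finite sums over sets disjoint from some A are bounded by 2; selecting the
   indices where Re or Im has a given sign bounds the sum of the moduli there. *)
Lemma sums_to_abs_bounded (I : choiceType) (u : I -> C) (s : C) :
  sums_to u s -> exists M, abs_bounded u M.
Proof.
move=> /sums_toP/(_ 1 ltr01)[A AP].
have tail (B : {fset I}) : [disjoint A & B]%fset -> `|\sum_(i <- B) u i| <= 2.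
  move=> AB.
  (* The sum over [B] is a difference of the errors left by [A] and by its union with [B], each at
     most 1. *)
  have -> : \sum_(i <- B) u i =
      (s - \sum_(i <- A) u i) - (s - \sum_(i <- (A `|` B)%fset) u i).
    rewrite (big_fsetID _ (mem A) (A `|` B)%fset) /=.
    have -> : [fset x in A `|` B | x \in A]%fset = A.
      by apply/fsetP => x; rewrite !inE /= andbC; case: (x \in A).
    have -> : [fset x in A `|` B | x \notin A]%fset = B.
      apply/fsetP => x; rewrite !inE /=; case xA: (x \in A) => //=.
        by apply/esym; have /fdisjointP/(_ x xA)/negbTE := AB.
      by rewrite andbT.
    by rewrite opprB [X in _ = X]addrC addrA subrK addrAC subrr add0r.
  rewrite (le_trans (ler_normB _ _)) // lerD ?AP ?fsubsetUl //.
have sub_disj (B B' : {fset I}) : [disjoint A & B]%fset -> (B' `<=` B)%fset ->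
    [disjoint A & B']%fset.
  by move=> AB B'B; apply: fdisjointWr AB.
have tail_abs (B : {fset I}) : [disjoint A & B]%fset ->
    \sum_(i <- B) `|u i| <= 8.
  (* The real part of [- 'i * u i] is ['Im (u i)], so [sum_Re_le] with bound 2 handles both parts
     and gives 4 for each. *)
  move=> AB; apply: le_trans (_ : \sum_(i <- B) (`|'Re (u i)| + `|'Re (- 'i * u i)|) <= _).
    apply: ler_sum => i _; rewrite mulNr raddfN /= ReMil opprK {1}[u i]Crect.
    by rewrite (le_trans (ler_normD _ _)) // normrM normCi mul1r.
  rewrite big_split /= (_ : 8 = (2 + 2) + (2 + 2)); last by rewrite -!natrD.
  apply: lerD; apply: sum_Re_le => B' /(sub_disj _ _ AB) AB'; first exact: tail.
  by rewrite -mulr_sumr normrM normrN normCi mul1r tail.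
exists (\sum_(i <- A) `|u i| + 8) => B.
rewrite (big_fsetID _ (mem A)) /= lerD //; last first.
  by apply: tail_abs; apply/fdisjointP => x xA; rewrite !inE xA andbF.
rewrite [leRHS](big_fsetID _ (mem B)) /=.
have -> : [fset x in A | x \in B]%fset = [fset x in B | x \in A]%fset.
  by apply/fsetP => x; rewrite !inE andbC.
by rewrite lerDl sumr_ge0.
Qed.

End UnconditionalSums.

(** * Double families: iterated sums and reindexing *)

Section DoubleSums.
Variable R : realType.
Local Notation C := R[i].

Lemma abs_bounded_ge0 (I : choiceType) (u : I -> C) (M : C) :
  abs_bounded u M -> 0 <= M.
Proof. by move=> /(_ fset0); rewrite big_seq_fset0. Qed.

Lemma abs_bounded_term (I : choiceType) (u : I -> C) (M : C) (i : I) :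
  abs_bounded u M -> `|u i| <= M.
Proof. by move=> /(_ [fset i]%fset); rewrite big_seq_fset1. Qed.

Lemma sums_to_sum (I J : choiceType) (u : I -> J -> C) (s : I -> C)
    (r : seq I) : (forall i, sums_to (u i) (s i)) ->
  sums_to (fun j => \sum_(i <- r) u i j) (\sum_(i <- r) s i).
Proof.
move=> us; elim: r => [|i r IH].
  rewrite big_nil; apply: (sums_to_ext (u := fun=> 0)) => [j|].
    by rewrite big_nil.
  have := @sums_to_fin_supp R J (fun=> 0) fset0 (fun _ _ => erefl).
  by rewrite big_seq_fset0.
rewrite big_cons; apply: (sums_to_ext _ (sums_toD (us i) IH)) => j.
by rewrite big_cons.
Qed.

Lemma big_fsetM (I J : choiceType) (A : {fset I}) (B : {fset J})
    (F : I * J -> C) :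
  \sum_(p <- (A `*` B)%fset) F p = \sum_(i <- A) \sum_(j <- B) F (i, j).
Proof.
rewrite -big_allpairs /=; apply: perm_big; apply: uniq_perm.
- exact: fset_uniq.
- by apply: allpairs_uniq; rewrite ?fset_uniq // => -[? ?] [? ?].
- move=> [i j]; rewrite in_fsetM /=; apply/idP/idP => [/andP[iA jB]|].
    by apply/allpairsP; exists (i, j).
  by case/allpairsP => -[i' j'] /= [? ? [-> ->]]; apply/andP.
Qed.

Lemma sub_fsetM (I J : choiceType) (K : {fset I * J}) (A : {fset I})
    (B : {fset J}) :
  ([fset p.1 | p in K] `<=` A)%fset -> ([fset p.2 | p in K] `<=` B)%fset ->
  (K `<=` A `*` B)%fset.
Proof.
move=> /fsubsetP KA /fsubsetP KB; apply/fsubsetP => p pK.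
by rewrite in_fsetM KA ?KB ?in_imfset.
Qed.

(** Once [A] contains the first projection of [K], the sums over rectangles [A * B] stay within [e]
    of [t]; letting [B] grow replaces each row by its sum. *)
Lemma sums_to_rows (I J : choiceType) (u : I -> J -> C) (s : I -> C) (t : C) :
  sums_to (fun p : I * J => u p.1 p.2) t ->
  (forall i, sums_to (u i) (s i)) -> sums_to s t.
Proof.
move=> /sums_toP ut us; apply/sums_toP => e /ut[K KP].
exists [fset p.1 | p in K]%fset => A KA.
have FF := @totally_filter J.
pose v j := \sum_(i <- A) u i j.
have vs : t - partial_sum v B @[B --> totally] --> t - \sum_(i <- A) s i.
  apply: (@cvgB C C _ _ FF (cst t) (partial_sum v)); first exact: cvg_cst.
  exact: sums_to_sum.
apply: (cvg_norm_le FF vs).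
apply: filterS (near_totally_sup [fset p.2 | p in K]%fset) => B KB.
rewrite partial_sumE exchange_big -(big_fsetM A B (fun p => u p.1 p.2)) KP //.
exact: sub_fsetM.
Qed.

(** A finite set of pairs lies in the rectangle spanned by its two projections, which is summed row
    by row. *)
Lemma abs_bounded_uncurry (I J : choiceType) (u : I -> J -> C) (M : I -> C)
    (B : C) :
  (forall i, abs_bounded (u i) (M i)) ->
  (forall A : {fset I}, \sum_(i <- A) M i <= B) ->
  abs_bounded (fun p : I * J => u p.1 p.2) B.
Proof.
move=> uM MB K.
pose A := [fset p.1 | p in K]%fset; pose A' := [fset p.2 | p in K]%fset.
apply: le_trans (MB A).
apply: le_trans (_ : \sum_(p <- (A `*` A')%fset) `|u p.1 p.2| <= _); last first.
  by rewrite big_fsetM; apply: ler_sum => i _; exact: uM.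
have KAA : (K `<=` A `*` A')%fset by exact: sub_fsetM.
rewrite [leRHS](big_fsetID _ (mem K)) /=.
have -> : [fset x in A `*` A' | x \in K]%fset = K.
  apply/fsetP => x; rewrite !inE /= andbC; case xK: (x \in K) => //=.
  by have := fsubsetP KAA x xK; rewrite in_fsetM => ->.
by rewrite lerDl sumr_ge0.
Qed.

Section Embedding.
Variables (I J : choiceType) (h : J -> I) (g : I -> J).
Hypothesis hK : cancel h g.

(** As [g] is a left inverse of [h], [h (g i) != i] says that [i] is outside the image of [h]. This
    serves to swap pairs and to shift multi-indices. *)
Lemma sum_fset_embed (u : I -> C) (B : {fset I}) :
  (forall i, h (g i) != i -> u i = 0) ->
  \sum_(i <- B) u i =
  \sum_(j <- [fset g i | i in [fset i in B | h (g i) == i]]%fset) u (h j).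
Proof.
move=> u0; rewrite (big_fsetID _ (fun i => h (g i) == i)) /=.
rewrite [X in _ + X]big1_seq ?addr0 => [|i]; last first.
  by rewrite !inE /= => /andP[_ /u0].
rewrite [RHS]big_imfset => [|x y]; last first.
  by rewrite !inE => /andP[_ /eqP {2}<-] /andP[_ /eqP {2}<-] ->.
by apply: eq_big_seq => i; rewrite !inE => /andP[_ /eqP ->].
Qed.

Lemma sums_to_embed (u : I -> C) (s : C) :
  (forall i, h (g i) != i -> u i = 0) -> sums_to (u \o h) s -> sums_to u s.
Proof.
move=> u0 /sums_toP us; apply/sums_toP => e /us[A AP].
exists [fset h j | j in A]%fset => B /fsubsetP AB.
rewrite sum_fset_embed //; apply: AP; apply/fsubsetP => j jA.
apply/imfsetP; exists (h j); rewrite ?hK //= !inE hK eqxx andbT.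
by apply: AB; rewrite in_imfset.
Qed.

Lemma abs_bounded_embed (u : I -> C) (M : C) :
  (forall i, h (g i) != i -> u i = 0) -> abs_bounded (u \o h) M ->
  abs_bounded u M.
Proof.
move=> u0 uM B; have := uM [fset g i | i in [fset i in B | h (g i) == i]]%fset.
apply: le_trans; rewrite le_eqVlt; apply/orP; left; apply/eqP.
by apply: sum_fset_embed => i /u0 ->; rewrite normr0.
Qed.

End Embedding.

Definition pair_swap (I J : Type) (p : I * J) : J * I := (p.2, p.1).

Lemma pair_swapK (I J : Type) : cancel (@pair_swap I J) (@pair_swap J I).
Proof. by case. Qed.

Lemma sums_to_cols (I J : choiceType) (u : I -> J -> C) (s : J -> C) (t : C) :
  sums_to (fun p : I * J => u p.1 p.2) t ->
  (forall j, sums_to (u^~ j) (s j)) -> sums_to s t.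
Proof.
move=> ut; apply: sums_to_rows.
apply: (sums_to_embed (@pair_swapK I J)) => [[j i]|]; first by rewrite eqxx.
by apply: sums_to_ext ut => -[].
Qed.

(** For finite [S] the moduli of the column sums are limits of those of partial columns over [A],
    which the rectangle [A * S] bounds uniformly in [A]. *)
Lemma abs_bounded_cols (I J : choiceType) (u : I -> J -> C) (c : J -> C)
    (B : C) :
  abs_bounded (fun p : I * J => u p.1 p.2) B ->
  (forall j, sums_to (u^~ j) (c j)) -> abs_bounded c B.
Proof.
move=> uB uc S; have FF := @totally_filter I.
have lim : forall r : seq J,
    \sum_(j <- r) `|partial_sum (u^~ j) A| @[A --> totally] -->
    \sum_(j <- r) `|c j|.
  elim=> [|j r IH].
    rewrite big_nil; under eq_fun do rewrite big_nil; exact: cvg_cst.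
  rewrite big_cons; under eq_fun do rewrite big_cons.
  exact: (@cvgD C C _ _ FF _ _ _ _ (@cvg_norm C C _ _ FF _ _ (uc j)) IH).
(* The sum is written as its own modulus so that [cvg_norm_le] can pass the bound to the limit. *)
rewrite -[X in X <= _]ger0_norm ?sumr_ge0 //.
apply: (cvg_norm_le FF (lim S)); apply: nearW => A.
rewrite ger0_norm ?sumr_ge0 //; apply: le_trans (uB (A `*` S)%fset).
rewrite big_fsetM exchange_big /=; apply: ler_sum => j _.
by rewrite partial_sumE ler_norm_sum.
Qed.

End DoubleSums.

(** * The weighted l1 algebra of power series on a polydisc *)

Section PowerSeriesAlgebra.
Variable R : realType.
Local Notation C := R[i].

Definition polydisc k (a : 'cV[C]_k) (r : C) : set 'cV[C]_k :=
  [set z | forall i, `|z i 0 - a i 0| <= r].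

(** This is [r ^ |alpha|], the weight of [alpha] in the l1 norm, kept as a product to match
    [power_series_term]. *)
Definition monomial k (r : C) (alpha : {ffun 'I_k -> nat}) : C :=
  \prod_(i < k) r ^+ alpha i.

(* The bound at the corner (r, ..., r) of the polydisc, where the modulus of each
   term is maximal. *)
Definition expands k (a : 'cV[C]_k) (r M : C) (F : 'cV[C]_k -> C) : Prop :=
  exists2 c : {ffun 'I_k -> nat} -> C,
    abs_bounded (fun alpha => c alpha * monomial r alpha) M
    & forall z, polydisc a r z -> sums_to (power_series_term c a z) (F z).

Lemma monomial_gt0 k (r : C) (alpha : {ffun 'I_k -> nat}) :
  0 < r -> 0 < monomial r alpha.
Proof. by move=> r0; apply: prodr_gt0 => i _; apply: exprn_gt0. Qed.

Lemma power_series_term_le k (c : {ffun 'I_k -> nat} -> C) (a z : 'cV[C]_k)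
    (r : C) (alpha : {ffun 'I_k -> nat}) : 0 <= r -> polydisc a r z ->
  `|power_series_term c a z alpha| <= `|c alpha * monomial r alpha|.
Proof.
move=> r0 az; rewrite !normrM ler_wpM2l // !normr_prod; apply: ler_prod => i _.
by rewrite normr_ge0 !normrX lerXn2r ?nnegrE // (ger0_norm r0).
Qed.

Lemma abs_bounded_le (I : choiceType) (u v : I -> C) (M : C) :
  (forall i, `|u i| <= `|v i|) -> abs_bounded v M -> abs_bounded u M.
Proof. by move=> uv vM A; apply: le_trans (vM A); apply: ler_sum. Qed.

Lemma abs_boundedZ (I : choiceType) (u : I -> C) (M b : C) :
  abs_bounded u M -> abs_bounded (fun i => b * u i) (`|b| * M).
Proof.
move=> uM A; under eq_bigr do rewrite normrM.
by rewrite -mulr_sumr ler_wpM2l.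
Qed.

Lemma expands_norm_le k (a z : 'cV[C]_k) (r M : C) (F : 'cV[C]_k -> C) :
  0 <= r -> expands a r M F -> polydisc a r z -> `|F z| <= M.
Proof.
move=> r0 [c cM cF] az; apply: sums_to_norm_le (cF z az) _.
by apply: abs_bounded_le cM => alpha; exact: power_series_term_le.
Qed.

Lemma expands_ext k (a : 'cV[C]_k) (r M : C) (F G : 'cV[C]_k -> C) :
  (forall z, polydisc a r z -> F z = G z) -> expands a r M F -> expands a r M G.
Proof.
by move=> FG [c cM cF]; exists c => [|z az]; [exact: cM | rewrite -(FG z az); exact: cF].
Qed.

Lemma expands_shrink k (a : 'cV[C]_k) (r r' M : C) (F : 'cV[C]_k -> C) :
  0 <= r' -> r' <= r -> expands a r M F -> expands a r' M F.
Proof.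
move=> r'0 r'r [c cM cF]; exists c => [|z az]; last first.
  by apply: cF => i; exact: le_trans (az i) r'r.
apply: abs_bounded_le cM => alpha; rewrite !normrM ler_wpM2l // !normr_prod.
apply: ler_prod => i _; rewrite normr_ge0 !normrX lerXn2r ?nnegrE //.
by rewrite !ger0_norm // (le_trans r'0).
Qed.

Lemma near_polydisc k (a : 'cV[C]_k) (r : C) : 0 < r ->
  \forall z \near a, polydisc a r z.
Proof.
move=> r0; apply/nbhs_ballP; exists r => //= z az i.
by case: az => _ /(_ i 0) az; rewrite distrC ltW.
Qed.

Lemma nbhs_polydisc k (a : 'cV[C]_k) (P : set 'cV[C]_k) :
  (\forall z \near a, P z) -> exists2 r : C, 0 < r & polydisc a r `<=` P.
Proof.
(* Balls are open and polydiscs closed, hence the half radius. *)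
move=> /nbhs_ballP[e /= e0 eP]; exists (e / 2); first by rewrite divr_gt0.
move=> z az; apply: eP; split => // i j; rewrite ord1.
rewrite /ball /= distrC (le_lt_trans (az i)) //.
by rewrite ltr_pdivrMr // ltr_pMr // ltr1n.
Qed.

Lemma expands_analytic_at k (a : 'cV[C]_k) (r M : C) (F : 'cV[C]_k -> C) :
  0 < r -> expands a r M F -> analytic_at F a.
Proof.
move=> r0 [c _ cF]; exists c.
by apply: filterS (near_polydisc a r0) => z; exact: cF.
Qed.

(** The series converges at the corner [a + (r, ..., r)], where its terms are exactly the weighted
    coefficients; unconditional convergence there makes them absolutely bounded. *)
Lemma analytic_at_expands k (a : 'cV[C]_k) (F : 'cV[C]_k -> C) :
  analytic_at F a -> exists r M : C, 0 < r /\ expands a r M F.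
Proof.
case=> c /nbhs_polydisc[r r0 cF]; exists r.
have : polydisc a r (a + const_mx r).
  by move=> i; rewrite !mxE addrAC subrr add0r ger0_norm // ltW.
move=> /cF/sums_to_abs_bounded[M cM]; exists M; split => //; exists c => // A.
apply: le_trans (cM A); apply: ler_sum => alpha _.
rewrite le_eqVlt; apply/orP; left; apply/eqP; congr (`|_ * _|).
by apply: eq_bigr => i _; rewrite !mxE addrAC subrr add0r.
Qed.

(** Coefficients are added index by index. The bound [B] makes the double family in [n] and [alpha]
    absolutely summable, so the two orders of summation agree. *)
Lemma expands_sums k (I : choiceType) (a : 'cV[C]_k) (r : C)
    (F_ : I -> 'cV[C]_k -> C) (M_ : I -> C) (F : 'cV[C]_k -> C) (B : C) :
  0 < r -> (forall n, expands a r (M_ n) (F_ n)) ->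
  (forall A : {fset I}, \sum_(n <- A) M_ n <= B) ->
  (forall z, polydisc a r z -> sums_to (F_^~ z) (F z)) ->
  expands a r B F.
Proof.
move=> r0 FM MB FF.
have /choice[c_ cP] : forall n, exists c : {ffun 'I_k -> nat} -> C,
    abs_bounded (fun alpha => c alpha * monomial r alpha) (M_ n) /\
    forall z, polydisc a r z -> sums_to (power_series_term c a z) (F_ n z).
  by move=> n; have [c cM cF] := FM n; exists c.
have cB := abs_bounded_uncurry (fun n => (cP n).1) MB.
have /choice[c cE] : forall alpha, exists s, sums_to (c_^~ alpha) s.
  move=> alpha.
  have [|s cs] :=
    @abs_bounded_summable R I (fun n => c_ n alpha * monomial r alpha) B.
    move=> A; apply: le_trans (MB A); apply: ler_sum => n _.
    exact: (abs_bounded_term alpha (cP n).1).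
  (* Only the weighted coefficients are known to be bounded, so they are summed first and the
     positive weight is divided out. *)
  exists ((monomial r alpha)^-1 * s).
  apply: (sums_to_ext _ (sums_toZ (a := (monomial r alpha)^-1) cs)) => n.
  by rewrite mulrC mulfK // gt_eqF // monomial_gt0.
(* The factor [b] is the weight of [alpha] for the norm bound, and the product of powers of [z - a]
   for the value. *)
have cZ b alpha : sums_to (fun n => c_ n alpha * b) (c alpha * b).
  rewrite mulrC; apply: (sums_to_ext _ (sums_toZ (a := b) (cE alpha))) => n.
  exact: mulrC.
exists c => [|z az]; first by apply: (abs_bounded_cols cB) => alpha; exact: cZ.
have uB : abs_bounded (fun p => power_series_term (c_ p.1) a z p.2) B.
  apply: abs_bounded_le cB => p; exact: power_series_term_le (ltW r0) az.
(* The total [t] is [F z] when summed over [n] last, and the value of the new series when summed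
   over [alpha] last. *)
have [t ut] := abs_bounded_summable uB.
have Ft := sums_to_rows ut (fun n => (cP n).2 z az).
rewrite (sums_to_unique (FF z az) Ft).
by apply: (sums_to_cols ut) => alpha; exact: cZ.
Qed.

Lemma power_series_term0 k (c : {ffun 'I_k -> nat} -> C) (a z : 'cV[C]_k) :
  power_series_term c a z [ffun=> 0%N] = c [ffun=> 0%N].
Proof. by rewrite /power_series_term big1 ?mulr1 // => i _; rewrite ffunE. Qed.

Lemma monomial0 k (r : C) : monomial r ([ffun=> 0%N] : {ffun 'I_k -> nat}) = 1.
Proof. by rewrite /monomial big1 // => i _; rewrite ffunE. Qed.

Lemma expands_cst k (a : 'cV[C]_k) (r b : C) : expands a r `|b| (fun=> b).
Proof.
pose o : {ffun 'I_k -> nat} := [ffun=> 0%N].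
exists (fun alpha => if alpha == o then b else 0) => [A|z _].
  case: (boolP (o \in A)) => oA; last first.
    rewrite big1_seq ?normr_ge0 // => alpha /andP[_ aA].
    case: eqP => [ao|_]; last by rewrite mul0r normr0.
    by rewrite -ao aA in oA.
  rewrite (big_fsetD1 o) //= eqxx monomial0 mulr1 big1_seq ?addr0 // => alpha.
  by rewrite !inE => /andP[_ /andP[/negbTE -> _]]; rewrite mul0r normr0.
rewrite [X in sums_to _ X](_ : b = \sum_(alpha <- [fset o]%fset)
    power_series_term (fun al => if al == o then b else 0) a z alpha).
  apply: sums_to_fin_supp => alpha; rewrite inE => /negbTE ao.
  by rewrite /power_series_term ao mul0r.
by rewrite big_seq_fset1 power_series_term0 eqxx.
Qed.

Lemma expandsZ k (a : 'cV[C]_k) (r M b : C) (F : 'cV[C]_k -> C) :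
  expands a r M F -> expands a r (`|b| * M) (fun z => b * F z).
Proof.
case=> c cM cF; exists (fun alpha => b * c alpha) => [|z az].
  by apply: abs_bounded_le (abs_boundedZ b cM) => alpha; rewrite mulrA.
by apply: (sums_to_ext _ (sums_toZ (a := b) (cF z az))) => alpha; exact: mulrA.
Qed.

Lemma expandsD k (a : 'cV[C]_k) (r M M' : C) (F G : 'cV[C]_k -> C) :
  expands a r M F -> expands a r M' G ->
  expands a r (M + M') (fun z => F z + G z).
Proof.
case=> c cM cF [d dM dG]; exists (fun alpha => c alpha + d alpha) => [A|z az].
  apply: le_trans (lerD (cM A) (dM A)); rewrite -big_split; apply: ler_sum => al _.
  by rewrite mulrDl ler_normD.
by apply: (sums_to_ext _ (sums_toD (cF z az) (dG z az))) => al; rewrite -mulrDl.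
Qed.

Lemma expands_shift k (a : 'cV[C]_k) (r M : C) (F : 'cV[C]_k -> C) (i : 'I_k) :
  0 <= r -> expands a r M F ->
  expands a r (r * M) (fun z => (z i 0 - a i 0) * F z).
Proof.
move=> r0 [c cM cF].
(* Multiplication by z_i - a_i moves the coefficient of index alpha to alpha + e_i. *)
pose up (al : {ffun 'I_k -> nat}) : {ffun 'I_k -> nat} :=
  [ffun j => (al j + (j == i))%N].
pose dn (al : {ffun 'I_k -> nat}) : {ffun 'I_k -> nat} :=
  [ffun j => (al j - (j == i))%N].
have upK : cancel up dn by move=> al; apply/ffunP => j; rewrite !ffunE addnK.
(* Truncated subtraction fails to be undone only at indices with [al i = 0], and these receive the
   coefficient 0. *)
have dnK al : up (dn al) != al -> al i = 0%N.
  apply: contraNeq => ali; apply/eqP/ffunP => j; rewrite !ffunE.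
  by case: eqP => [->|_]; rewrite ?subn0 ?addn0 // subnK // lt0n.
have prodE (x : 'I_k -> C) al :
    \prod_j x j ^+ up al j = x i * \prod_j x j ^+ al j.
  rewrite (bigD1 i) //= [in RHS](bigD1 i) //= ffunE eqxx addn1 exprS -mulrA.
  congr (_ * (_ * _)); apply: eq_bigr => j /negbTE ji.
  by rewrite ffunE ji addn0.
exists (fun al : {ffun 'I_k -> nat} => if al i == 0%N then 0 else c (dn al))
  => [|z az].
  apply: (@abs_bounded_embed R _ _ up dn) => [al /dnK ->|]; first by rewrite mul0r.
  rewrite -{2}(ger0_norm r0); apply: abs_bounded_le (abs_boundedZ r cM) => al /=.
  by rewrite ffunE eqxx addn1 /= upK /monomial (prodE (fun=> r)) mulrCA.
apply: (sums_to_embed upK) => [al /dnK ali|].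
  by rewrite /power_series_term ali mul0r.
apply: (sums_to_ext _ (sums_toZ (a := z i 0 - a i 0) (cF z az))) => al /=.
rewrite /power_series_term ffunE eqxx addn1 /= upK.
by rewrite (prodE (fun j => z j 0 - a j 0)) mulrCA.
Qed.

Lemma expands_shift_monomial k (a : 'cV[C]_k) (r M : C) (F : 'cV[C]_k -> C)
    (alpha : {ffun 'I_k -> nat}) : 0 <= r -> expands a r M F ->
  expands a r (monomial r alpha * M)
    (fun z => (\prod_(i < k) (z i 0 - a i 0) ^+ alpha i) * F z).
Proof.
move=> r0 FM; rewrite /monomial.
elim: (index_enum _) => [|i s IH].
  by rewrite big_nil mul1r; apply: expands_ext FM => z _; rewrite big_nil mul1r.
rewrite big_cons -mulrA.
apply: (@expands_ext _ _ _ _ (fun z => (z i 0 - a i 0) ^+ alpha i *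
    ((\prod_(j <- s) (z j 0 - a j 0) ^+ alpha j) * F z))) => [z _|].
  by rewrite big_cons mulrA.
elim: (alpha i) => [|n IHn].
  by rewrite mul1r; apply: expands_ext IH => z _; rewrite mul1r.
rewrite exprS -mulrA; apply: expands_ext (expands_shift i r0 IHn) => z _.
by rewrite exprS -!mulrA.
Qed.

(** The product is the sum over [alpha] of [c alpha] times a shifted copy of [G], of norm
    [|c alpha| r^|alpha| M']; no Cauchy product is written out. *)
Lemma expandsM k (a : 'cV[C]_k) (r M M' : C) (F G : 'cV[C]_k -> C) :
  0 < r -> expands a r M F -> expands a r M' G ->
  expands a r (M * M') (fun z => F z * G z).
Proof.
move=> r0 [c cM cF] GM'.
apply: (expands_sums r0 (fun alpha => expandsZ (c alpha)
  (expands_shift_monomial alpha (ltW r0) GM'))) => [A|z az].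
  have M'0 : 0 <= M' by case: GM' => d /abs_bounded_ge0.
  apply: le_trans (ler_wpM2r M'0 (cM A)); rewrite mulr_suml; apply: ler_sum => al _.
  by rewrite normrM mulrA (ger0_norm (ltW (monomial_gt0 _ r0))).
rewrite mulrC; apply: (sums_to_ext _ (sums_toZ (a := G z) (cF z az))) => al.
by rewrite mulrC /power_series_term mulrA.
Qed.

Lemma expandsX k (a : 'cV[C]_k) (r M : C) (F : 'cV[C]_k -> C) n :
  0 < r -> expands a r M F -> expands a r (M ^+ n) (fun z => F z ^+ n).
Proof.
move=> r0 FM; elim: n => [|n IH].
  by have := expands_cst a r 1; rewrite normr1.
rewrite exprS; apply: expands_ext (expandsM r0 FM IH) => z _.
by rewrite exprS.
Qed.

Lemma expands_prod k (a : 'cV[C]_k) (r : C) (I : Type) (s : seq I)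
    (M_ : I -> C) (F_ : I -> 'cV[C]_k -> C) : 0 < r ->
  (forall i, expands a r (M_ i) (F_ i)) ->
  expands a r (\prod_(i <- s) M_ i) (fun z => \prod_(i <- s) F_ i z).
Proof.
move=> r0 FM; elim: s => [|i s IH].
  have := expands_cst a r 1; rewrite normr1 big_nil.
  by apply: expands_ext => z _; rewrite big_nil.
rewrite big_cons; apply: expands_ext (expandsM r0 (FM i) IH) => z _.
by rewrite big_cons.
Qed.

(** The products of powers of [G_i - b_i] have norm at most [rho^|alpha|], exactly the weight under
    which the coefficients of [F] sum to at most [M]. *)
Lemma expands_comp k n (a : 'cV[C]_k) (b : 'cV[C]_n) (r rho M : C)
    (F : 'cV[C]_n -> C) (G : 'cV[C]_k -> 'cV[C]_n) : 0 < r -> 0 < rho ->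
  expands b rho M F -> (forall i, expands a r rho (fun z => G z i 0 - b i 0)) ->
  expands a r M (fun z => F (G z)).
Proof.
move=> r0 rho0 [c cM cF] GE.
apply: (expands_sums r0 (fun alpha => expandsZ (c alpha)
  (expands_prod (index_enum _) r0 (fun i => expandsX (alpha i) r0 (GE i))))) => [A|z az].
  apply: le_trans (cM A); apply: ler_sum => al _.
  by rewrite normrM (ger0_norm (ltW (monomial_gt0 _ rho0))).
(* The norm also bounds values, so [G z] stays in the polydisc where [F] is given by its series. *)
by apply: cF => i; exact: expands_norm_le (ltW r0) (GE i) az.
Qed.

Lemma expands_small k (a : 'cV[C]_k) (r M rho : C) (F : 'cV[C]_k -> C) :
  0 < r -> 0 < rho -> expands a r M F -> F a = 0 ->
  exists2 r0, 0 < r0 & forall r', 0 < r' -> r' <= r0 -> expands a r' rho F.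
Proof.
move=> r0 rho0 [c cM cF] Fa0; have M0 := abs_bounded_ge0 cM.
have Mrho : 0 < M + rho by rewrite ltr_wpDl.
(* This choice gives [t * M <= rho] and [t <= 1], also when [M = 0]. *)
pose t := rho / (M + rho).
have t0 : 0 < t by rewrite divr_gt0.
have t1 : t <= 1 by rewrite ler_pdivrMr // mul1r lerDr.
(* Since c_0 = F a = 0, scaling the radius by t <= 1 scales the norm by at most t. *)
exists (t * r) => [|r' r'0 r'r]; first by rewrite mulr_gt0.
(* At the centre only the constant term survives. *)
have c0 : c [ffun=> 0%N] = 0.
  have aa : polydisc a r a by move=> i; rewrite subrr normr0 ltW.
  rewrite -Fa0; apply: sums_to_unique _ (cF a aa).
  rewrite (_ : c _ = \sum_(al <- [fset [ffun=> 0%N]]%fset)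
      power_series_term c a a al); last first.
    by rewrite big_seq_fset1 power_series_term0.
  apply: sums_to_fin_supp => al; rewrite inE => al0.
  have [i ali] : exists i, al i != 0%N.
    apply/existsP; rewrite -negb_forall; apply: contra al0 => /forallP al0.
    by apply/eqP/ffunP => i; rewrite ffunE; apply/eqP.
  by rewrite /power_series_term (bigD1 i) //= subrr expr0n (negbTE ali) mul0r mulr0.
exists c => [A|z az]; last first.
  apply: cF => i; apply: le_trans (az i) _; apply: le_trans r'r _.
  by rewrite ler_piMl // ltW.
apply: le_trans (_ : t * M <= _); last first.
  by rewrite /t mulrAC ler_pdivrMr // ler_wpM2l // ?lerDl ltW.
apply: le_trans (ler_wpM2l (ltW t0) (cM A)); rewrite mulr_sumr.
apply: ler_sum => al _; have [->|al0] := eqVneq al [ffun=> 0%N].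
  by rewrite c0 !mul0r normr0 mulr0.
have [i ali] : exists i, al i != 0%N.
  apply/existsP; rewrite -negb_forall; apply: contra al0 => /forallP al0.
  by apply/eqP/ffunP => i; rewrite ffunE; apply/eqP.
rewrite !normrM mulrCA ler_wpM2l // !gtr0_norm ?monomial_gt0 //.
apply: le_trans (_ : monomial (t * r) al <= _).
  apply: ler_prod => j _; apply/andP; split; first by rewrite exprn_ge0 // ltW.
  by rewrite lerXn2r // nnegrE ltW // mulr_gt0.
rewrite /monomial; under eq_bigr do rewrite exprMn.
rewrite big_split /= ler_wpM2r //; first by rewrite ltW // monomial_gt0.
(* One index [i] with [al i >= 1] supplies a factor [t]; all other powers of [t] are at most 1. *)
rewrite (bigD1 i) //= -[leRHS]mulr1; apply: ler_pM.
- by rewrite exprn_ge0 // ltW.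
- by apply: prodr_ge0 => j _; rewrite exprn_ge0 // ltW.
- rewrite -(prednK (n := al i)) ?lt0n // exprS; apply: ler_piMr (ltW t0) _.
  exact: exprn_ile1 (ltW t0) t1.
- apply: prodr_ile1 => j; rewrite exprn_ge0 ?(ltW t0) //.
  by rewrite exprn_ile1 ?(ltW t0).
Qed.

(** * The geometric series *)

Lemma sum_half_pow_le (A : {fset nat}) : \sum_(n <- A) (2^-1 : C) ^+ n <= 2.
Proof.
(* Each element of [A] is at most the sum of all, so [A] lies in the initial segment of length
   [N]. *)
pose N := (\sum_(n <- A) n).+1.
apply: le_trans (_ : \sum_(n < N) (2^-1 : C) ^+ n <= _).
  rewrite -(big_mkord xpredT (fun n => (2^-1 : C) ^+ n)) /index_iota subn0.
  rewrite (_ : \sum_(n <- A) _ = \sum_(n <- iota 0 N | n \in A) (2^-1 : C) ^+ n).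
    by rewrite [leRHS](bigID (mem A)) /= lerDl sumr_ge0.
  rewrite -[RHS]big_filter; apply: perm_big; apply: uniq_perm.
  - exact: fset_uniq.
  - by rewrite filter_uniq // iota_uniq.
  - move=> n; rewrite mem_filter mem_iota /= add0n ltnS.
    case nA: (n \in A); rewrite ?andbF //=; apply/esym.
    by rewrite (big_fsetD1 n) //= leq_addr.
suff : \sum_(n < N) (2^-1 : C) ^+ n = 2 - 2 * 2^-1 ^+ N.
  by move=> ->; rewrite lerBlDr lerDl mulr_ge0 // exprn_ge0.
elim: N => [|N IH]; first by rewrite big_ord0 expr0 mulr1 subrr.
rewrite big_ord_recr /= IH exprS mulrA divff ?pnatr_eq0 // mul1r.
by rewrite mulr_natl mulr2n opprD !addrA addrNK.
Qed.

Lemma sums_to_geometric (h : C) : `|h| <= 2^-1 ->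
  sums_to (fun n => h ^+ n) (1 - h)^-1.
Proof.
move=> h2.
have hB : abs_bounded (fun n => h ^+ n) 2.
  move=> A; apply: le_trans (sum_half_pow_le A); apply: ler_sum => n _.
  by rewrite normrX lerXn2r // nnegrE.
have [s hs] := abs_bounded_summable hB.
have h1 : 1 - h != 0.
  rewrite subr_eq0; apply: contraTneq h2 => <-; rewrite normr1.
  by rewrite lt_geF // invf_lt1 ?ltr1n.
suff -> : (1 - h)^-1 = s by [].
(* The sum s satisfies s = 1 + h * s. *)
suff sE : s - (1 + h * s) = 0.
  apply: (mulfI h1); rewrite divff // mulrBl mul1r; apply/eqP.
  by rewrite -subr_eq0 -oppr_eq0 opprB addrAC -addrA -opprD sE.
apply/eqP; rewrite -normr_le0; apply/ler_addgt0Pr => e e0; rewrite add0r.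
have [//|A AP] := (sums_toP _ _).1 hs (e / 2); first by rewrite divr_gt0.
pose N := (\sum_(n <- A) n).+1.
have SP n : (N <= n)%N -> `|s - \sum_(i < n) h ^+ i| <= e / 2.
  move=> Nn; have := AP [fset i in iota 0 n]%fset.
  rewrite big_imfset //= -(big_mkord xpredT (fun i => h ^+ i)) /index_iota subn0.
  rewrite undup_id ?iota_uniq //; apply.
  apply/fsubsetP => i iA; rewrite !inE mem_iota add0n /=.
  by apply: leq_trans Nn; rewrite ltnS (big_fsetD1 i) //= leq_addr.
(* Multiplying by [h] and adding 1 turns the partial sum of length [N] into that of length [N.+1],
   so the defect is made of two tails of size at most [e / 2]. *)
have -> : s - (1 + h * s) =
    (s - \sum_(i < N.+1) h ^+ i) - h * (s - \sum_(i < N) h ^+ i).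
  rewrite big_ord_recl expr0 mulrBr mulr_sumr.
  under [in RHS]eq_bigr do rewrite lift0 exprS.
  by rewrite opprB addrA [in RHS]opprD addrA subrK -addrA -opprD.
apply: le_trans (ler_normB _ _) _; rewrite [leRHS](splitr e) lerD ?SP //.
rewrite normrM -[leRHS]mul1r ler_pM ?SP //.
by rewrite (le_trans h2) // invf_le1 ?ler1n.
Qed.

(** The powers of [H] have norms [2^-n], whose finite sums are at most 2. *)
Lemma expands_geometric k (a : 'cV[C]_k) (r : C) (H : 'cV[C]_k -> C) :
  0 < r -> expands a r 2^-1 H -> expands a r 2 (fun z => (1 - H z)^-1).
Proof.
move=> r0 HE; apply: (expands_sums r0 (fun n => expandsX n r0 HE)).
  exact: sum_half_pow_le.
by move=> z az; apply: sums_to_geometric; exact: expands_norm_le (ltW r0) HE az.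
Qed.

End PowerSeriesAlgebra.

(** * Closure properties of functions analytic at a point *)

Section AnalyticFunctions.
Variables (R : realType) (k : nat) (a : 'cV[R[i]]_k).
Local Notation C := R[i].
Implicit Types F G : 'cV[C]_k -> C.

(** The inverse of [1 + S] stands in for a minimum; the added 1 covers the empty family. *)
Lemma common_radius (I : finType) (r : I -> C) : (forall i, 0 < r i) ->
  exists2 r0, 0 < r0 & forall i, r0 <= r i.
Proof.
move=> r_gt0; pose S := \sum_i (r i)^-1.
have S0 : 0 <= S by apply: sumr_ge0 => i _; rewrite invr_ge0 ltW.
have S1 : 0 < 1 + S by rewrite ltr_pwDl.
exists (1 + S)^-1 => [|i]; first by rewrite invr_gt0.
rewrite -[leRHS]invrK lef_pV2 ?posrE ?invr_gt0 //.
rewrite /S (bigD1 i) //= addrCA lerDl addr_ge0 // sumr_ge0 // => j _.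
by rewrite invr_ge0 ltW.
Qed.

Lemma analytic_at_near F G :
  (\forall z \near a, F z = G z) -> analytic_at F a -> analytic_at G a.
Proof.
move=> FG [c cF]; exists c.
apply: (@filterS2 _ (nbhs a) _ _ _ _ _ FG cF) => z ->; exact: id.
Qed.

Lemma analytic_at_eq F G :
  (forall z, F z = G z) -> analytic_at F a -> analytic_at G a.
Proof. by move=> /funext ->. Qed.

Lemma analytic_at_cst b : analytic_at (fun=> b) a.
Proof. exact: expands_analytic_at ltr01 (expands_cst a 1 b). Qed.

Lemma analytic_at_coord i : analytic_at (fun z => z i 0) a.
Proof.
apply: (expands_analytic_at (r := 1)) => //.
apply: expands_ext (expandsD (expands_cst a 1 (a i 0))
  (expands_shift i ler01 (expands_cst a 1 1))) => z _.
by rewrite mulr1 addrC subrK.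
Qed.

Lemma analytic_at_expands2 F G : analytic_at F a -> analytic_at G a ->
  exists r M M', [/\ 0 < r, expands a r M F & expands a r M' G].
Proof.
move=> /analytic_at_expands[r [M [r0 FM]]] /analytic_at_expands[r' [M' [r'0 GM']]].
have [|e e0 er] := @common_radius bool (fun b => if b then r else r').
  by case.
exists e, M, M'; split=> //.
- exact: expands_shrink (ltW e0) (er true) FM.
- exact: expands_shrink (ltW e0) (er false) GM'.
Qed.

Lemma analytic_atD F G :
  analytic_at F a -> analytic_at G a -> analytic_at (fun z => F z + G z) a.
Proof.
move=> Fa /(analytic_at_expands2 Fa)[r [M [M' [r0 FM GM]]]].
exact: expands_analytic_at r0 (expandsD FM GM).
Qed.

Lemma analytic_atM F G :
  analytic_at F a -> analytic_at G a -> analytic_at (fun z => F z * G z) a.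
Proof.
move=> Fa /(analytic_at_expands2 Fa)[r [M [M' [r0 FM GM]]]].
exact: expands_analytic_at r0 (expandsM r0 FM GM).
Qed.

Lemma analytic_atB F G :
  analytic_at F a -> analytic_at G a -> analytic_at (fun z => F z - G z) a.
Proof.
move=> Fa Ga; have := analytic_atD Fa (analytic_atM (analytic_at_cst (-1)) Ga).
by apply: analytic_at_eq => z; rewrite mulN1r.
Qed.

Lemma analytic_at_sum (I : Type) (s : seq I) (F : I -> 'cV[C]_k -> C) :
  (forall i, analytic_at (F i) a) ->
  analytic_at (fun z => \sum_(i <- s) F i z) a.
Proof.
move=> Fa; elim: s => [|i s IH].
  apply: analytic_at_eq (analytic_at_cst 0) => z.
  by rewrite big_nil.
apply: analytic_at_eq (analytic_atD (Fa i) IH) => z.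
by rewrite big_cons.
Qed.

Lemma analytic_at_prod (I : Type) (s : seq I) (F : I -> 'cV[C]_k -> C) :
  (forall i, analytic_at (F i) a) ->
  analytic_at (fun z => \prod_(i <- s) F i z) a.
Proof.
move=> Fa; elim: s => [|i s IH].
  apply: analytic_at_eq (analytic_at_cst 1) => z.
  by rewrite big_nil.
apply: analytic_at_eq (analytic_atM (Fa i) IH) => z.
by rewrite big_cons.
Qed.

Lemma analytic_at_comp n (F : 'cV[C]_n -> C) (G : 'cV[C]_k -> 'cV[C]_n) :
  analytic_at F (G a) -> (forall i, analytic_at (fun z => G z i 0) a) ->
  analytic_at (fun z => F (G z)) a.
Proof.
move=> /analytic_at_expands[rho [M [rho0 FM]]] Ga.
(* [G_i - G_i(a)] vanishes at [a], so its norm is at most [rho] at every small radius, and one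
   radius can serve all coordinates. *)
have /choice[r rP] : forall i, exists r, 0 < r /\ forall r', 0 < r' -> r' <= r ->
    expands a r' rho (fun z => G z i 0 - G a i 0).
  move=> i; have := analytic_atB (Ga i) (analytic_at_cst (G a i 0)).
  move=> /analytic_at_expands[r [M' [r0 GM]]].
  have [|r1 r10 r1P] := expands_small r0 rho0 GM; first by rewrite subrr.
  by exists r1.
have [r0 r00 r0r] := common_radius (fun i => (rP i).1).
apply: (expands_analytic_at (M := M) r00).
by apply: (expands_comp r00 rho0 FM) => i; exact: (rP i).2 r00 (r0r i).
Qed.

(** With [H = 1 - F / F(a)], which vanishes at [a], one has [1 / F = F(a)^-1 / (1 - H)]; shrinking
    the radius brings the norm of [H] down to [1/2]. *)
Lemma analytic_atV F : F a != 0 -> analytic_at F a ->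
  analytic_at (fun z => (F z)^-1) a.
Proof.
move=> Fa0 Fa; pose H z := 1 - (F a)^-1 * F z.
have Ha : analytic_at H a.
  exact: analytic_atB (analytic_at_cst 1) (analytic_atM (analytic_at_cst _) Fa).
have [r [M [r0 HM]]] := analytic_at_expands Ha.
have [||r1 r10 r1P] := @expands_small _ _ _ _ _ 2^-1 _ r0 _ HM.
- by rewrite invr_gt0.
- by rewrite /H mulVf // subrr.
have geo := expands_analytic_at r10 (expands_geometric r10 (r1P _ r10 (lexx _))).
apply: analytic_at_eq (analytic_atM (analytic_at_cst (F a)^-1) geo) => z.
by rewrite /H opprB addrC subrK invfM invrK mulrA mulVf // mul1r.
Qed.

(** * Analytic matrices: determinant, adjugate, inverse and product *)

Lemma analytic_at_det n (A : 'cV[C]_k -> 'M[C]_n) :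
  (forall i j, analytic_at (fun z => A z i j) a) ->
  analytic_at (fun z => \det (A z)) a.
Proof.
move=> Aa; apply: analytic_at_sum => s; apply: analytic_atM.
  exact: analytic_at_cst.
by apply: analytic_at_prod => i; exact: Aa.
Qed.

Lemma analytic_at_adj n (A : 'cV[C]_k -> 'M[C]_n) i j :
  (forall i j, analytic_at (fun z => A z i j) a) ->
  analytic_at (fun z => (\adj (A z)) i j) a.
Proof.
move=> Aa; have := analytic_atM (analytic_at_cst ((-1) ^+ (j + i)))
  (@analytic_at_det _ (fun z => row' j (col' i (A z))) _).
have H : forall i0 j0, analytic_at (fun z => row' j (col' i (A z)) i0 j0) a.
  move=> i0 j0; apply: analytic_at_eq (Aa (lift j i0) (lift i j0)) => z.
  by rewrite !mxE.
move=> /(_ H); apply: analytic_at_eq => z.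
by rewrite mxE.
Qed.

(** [invmx] is the adjugate over the determinant only at invertible matrices, so invertibility is
    assumed on a neighbourhood. *)
Lemma analytic_at_invmx n (A : 'cV[C]_k -> 'M[C]_n) i j :
  (\forall z \near a, A z \in unitmx) ->
  (forall i j, analytic_at (fun z => A z i j) a) ->
  analytic_at (fun z => invmx (A z) i j) a.
Proof.
move=> Au Aa; have detA0 : \det (A a) != 0.
  by rewrite -unitfE -unitmxE; exact: nbhs_singleton Au.
have := analytic_atM (analytic_atV detA0 (analytic_at_det Aa)) (analytic_at_adj i j Aa).
apply: analytic_at_near; apply: filterS Au => z Azu.
by rewrite /invmx Azu [RHS]mxE.
Qed.

Lemma analytic_at_mulmx m n p (A : 'cV[C]_k -> 'M[C]_(m, n))
    (B : 'cV[C]_k -> 'M[C]_(n, p)) i j :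
  (forall i j, analytic_at (fun z => A z i j) a) ->
  (forall i j, analytic_at (fun z => B z i j) a) ->
  analytic_at (fun z => (A z *m B z) i j) a.
Proof.
move=> Aa Ba.
have := analytic_at_sum (index_enum _) (fun l => analytic_atM (Aa i l) (Ba l j)).
by apply: analytic_at_eq => z; rewrite mxE.
Qed.

End AnalyticFunctions.

(** * Invertibility of the Jacobian and analyticity of the Newton iterates *)

Section NewtonIteration.
Variable R : realType.
Local Notation C := R[i].

Lemma cplx_col_mx m n (x : 'cV[R]_m) (y : 'cV[R]_n) :
  cplx (col_mx x y) = col_mx (cplx x) (cplx y).
Proof. exact: map_col_mx. Qed.

(** [realify A] is the matrix of [v |-> A *m v] in real coordinates [(Re v, Im v)]. *)
Lemma realify_mul_col m (A : 'M[C]_m) (v : 'cV[C]_m) : A *m v = 0 ->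
  realify A *m col_mx (map_mx (@complex.Re R) v) (map_mx (@complex.Im R) v) = 0.
Proof.
move=> Av; rewrite /realify mul_block_col -[RHS]col_mx0.
congr col_mx; apply/matrixP => i j.
  have /matrixP/(_ i j)/(congr1 (@complex.Re R)) := Av.
  rewrite !mxE raddf_sum /= => E; rewrite -[RHS]E -big_split; apply: eq_bigr => l _.
  rewrite !mxE; case: (A i l) => ? ?; case: (v l j) => ? ? /=.
  by rewrite mulNr.
have /matrixP/(_ i j)/(congr1 (@complex.Im R)) := Av.
rewrite !mxE raddf_sum /= => E; rewrite -[RHS]E -big_split; apply: eq_bigr => l _.
rewrite !mxE; case: (A i l) => ? ?; case: (v l j) => ? ? /=.
by rewrite addrC mulrC.
Qed.

(** A kernel vector of a singular [A] gives one of [realify A], so 0 is a singular value and the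
    infimum is at most 0. *)
Lemma sigma_min_gt0_unitmx m (A : 'M[C]_m) :
  0 < sigma_min (realify A) -> A \in unitmx.
Proof.
apply: contraLR => Au; rewrite -leNgt; apply: ge_inf.
  by exists 0 => s [].
split=> //.
(* [det0P] and [eigenvalueP] speak of row vectors, hence the transposes. *)
have [v v0 vA] : exists2 v : 'rV_m, v != 0 & v *m A^T = 0.
  by apply/det0P; rewrite det_tr; move: Au; rewrite unitmxE unitfE negbK.
have Av : A *m v^T = 0 by rewrite -[A]trmxK -trmx_mul vA trmx0.
pose w := col_mx (map_mx (@complex.Re R) v^T) (map_mx (@complex.Im R) v^T).
have Aw : realify A *m w = 0 by exact: realify_mul_col.
apply/eigenvalueP; exists w^T.
  by rewrite mulmxA -trmx_mul Aw trmx0 mul0mx expr0n scale0r.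
apply: contra v0; rewrite -trmx0 (inj_eq trmx_inj) => /eqP.
rewrite -[0]col_mx0 => /eq_col_mx[/matrixP vR /matrixP vI].
apply/eqP/matrixP => i j; have := vR j i; have := vI j i; rewrite !mxE.
by case: (v i j) => x y /= -> ->.
Qed.

(** The embedding of [R] in [R[i]] is a field morphism, so it commutes entrywise with [invmx],
    default value included. *)
Lemma cplx_newton_map m N (f : 'cV[R]_m -> 'cV[R]_N -> 'cV[R]_m)
    (J : 'cV[R]_m -> 'cV[R]_N -> 'M[R]_m)
    (F : 'cV[C]_m -> 'cV[C]_N -> 'cV[C]_m) (JC : 'cV[C]_m -> 'cV[C]_N -> 'M[C]_m)
    (x : 'cV[R]_m) (q : 'cV[R]_N) :
  F (cplx x) (cplx q) = cplx (f x q) -> JC (cplx x) (cplx q) = cplx (J x q) ->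
  newton_map F JC (cplx x) (cplx q) = cplx (newton_map f J x q).
Proof.
move=> Ff JJ; rewrite /newton_map Ff JJ /cplx.
by rewrite map_mxB map_mxM map_invmx.
Qed.

(** Composition of the jointly analytic [F] with [g |-> (X g, g)]. *)
Lemma analytic_on_joint m N p n (Theta : set 'cV[C]_m) (Psi : set 'cV[C]_N)
    (F : 'cV[C]_m -> 'cV[C]_N -> 'M[C]_(p, n)) (X : 'cV[C]_N -> 'cV[C]_m) :
  analytic_on (prod_set Theta Psi) (joint F) -> analytic_on Psi X ->
  (forall g, Psi g -> Theta (X g)) -> analytic_on Psi (fun g => F (X g) g).
Proof.
move=> Fa Xa XT g Pg i j.
have wa : analytic_at (fun w => joint F w i j) (col_mx (X g) g).
  by apply: Fa; rewrite /prod_set /= col_mxKu col_mxKd; split => //; exact: XT.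
have := @analytic_at_comp R N g _ _ (fun g => col_mx (X g) g) wa _.
have Ga l : analytic_at (fun z => col_mx (X z) z l 0) g.
  case: (split_ordP l) => l' ->.
    by apply: analytic_at_eq (Xa g Pg l' 0) => z; rewrite col_mxEu.
  by apply: analytic_at_eq (analytic_at_coord g l') => z; rewrite col_mxEd.
by move=> /(_ Ga); apply: analytic_at_eq => z; rewrite /joint col_mxKu col_mxKd.
Qed.

Lemma analytic_on_newton_map m N (Theta : set 'cV[C]_m) (Psi : set 'cV[C]_N)
    (F : 'cV[C]_m -> 'cV[C]_N -> 'cV[C]_m) (J : 'cV[C]_m -> 'cV[C]_N -> 'M[C]_m)
    (X : 'cV[C]_N -> 'cV[C]_m) : open Psi ->
  analytic_on (prod_set Theta Psi) (joint F) ->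
  analytic_on (prod_set Theta Psi) (joint J) ->
  (forall z g, Theta z -> Psi g -> J z g \in unitmx) ->
  analytic_on Psi X -> (forall g, Psi g -> Theta (X g)) ->
  analytic_on Psi (fun g => newton_map F J (X g) g).
Proof.
move=> Po Fa Ja Ju Xa XT g Pg i j.
have FXa := analytic_on_joint Fa Xa XT Pg.
have JXa := analytic_on_joint Ja Xa XT Pg.
have JXu : \forall z \near g, J (X z) z \in unitmx.
  have : \forall z \near g, Psi z by exact: open_nbhs_nbhs.
  by apply: filterS => z Pz; apply: Ju => //; exact: XT.
have := analytic_atB (Xa g Pg i j)
  (analytic_at_mulmx i j (fun i j => analytic_at_invmx i j JXu JXa) FXa).
by apply: analytic_at_eq => z; rewrite /newton_map [RHS]mxE [X in _ = _ + X]mxE.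
Qed.

End NewtonIteration.

Theorem theorem3 (R : realType) (m N : nat) (hm : (1 <= m)%N) (hN : (1 <= N)%N)
  (D : set 'cV[R]_m) (D_open : open D)
  (D_convex : convex_set (D : set (convex_lmodType 'cV[R]_m)))
  (f : 'cV[R]_m -> 'cV[R]_N -> 'cV[R]_m)
  (f_diff : forall x q, D x -> cube q -> differentiable (f^~ q) x)
  (Psi : set 'cV[R[i]]_N) (Psi_domain : is_domain Psi)
  (Gamma_Psi : [set cplx q | q in @cube R N] `<=` Psi)
  (Dv : nat -> set 'cV[R]_m) (Dv_D : forall v, Dv v `<=` D)
  (x0 : 'cV[R]_m) (x0_D0 : Dv 0%N x0)
  (newton_Dv : forall v q x, cube q -> Dv v x ->
     Dv v.+1 (newton_map f (jacobian_x f) x q))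
  (Theta : nat -> set 'cV[R[i]]_m)
  (Theta_domain : forall v, is_domain (Theta v))
  (Dv_Theta : forall v, [set cplx x | x in Dv v] `<=` Theta v)
  (fv : nat -> 'cV[R[i]]_m -> 'cV[R[i]]_N -> 'cV[R[i]]_m)
  (Jv : nat -> 'cV[R[i]]_m -> 'cV[R[i]]_N -> 'M[R[i]]_m)
  (newton_Theta : forall v g z, Psi g -> Theta v z ->
     Theta v.+1 (newton_map (fv v) (Jv v) z g))
  (fv_ext : forall v,
     analytic_extension (prod_set (Dv v) (@cube R N)) (joint f)
       (prod_set (Theta v) Psi) (joint (fv v)))
  (Jv_ext : forall v,
     analytic_extension (prod_set (Dv v) (@cube R N)) (joint (jacobian_x f))
       (prod_set (Theta v) Psi) (joint (Jv v)))
  (Jv_sigma : forall v, exists2 c : R, 0 < c & forall z g, Theta v z -> Psi g ->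
     c <= sigma_min (realify (Jv v z g))) :
  forall v, exists X : 'cV[R[i]]_N -> 'cV[R[i]]_m,
    analytic_extension (@cube R N) (newton_iter f (jacobian_x f) x0 v) Psi X.
Proof.
have Jv_unit v z g : Theta v z -> Psi g -> Jv v z g \in unitmx.
  move=> Tz Pg; have [c c0 /(_ z g Tz Pg) cJ] := Jv_sigma v.
  by apply: sigma_min_gt0_unitmx; exact: lt_le_trans c0 cJ.
move=> v.
(* The induction also carries the location of both iterates, in [Theta v] and [Dv v], where the
   extensions of stage [v] are available. *)
suff [X [Xa XT XE]] : exists X : 'cV[R[i]]_N -> 'cV[R[i]]_m,
    [/\ analytic_on Psi X, forall g, Psi g -> Theta v (X g)
      & forall q, cube q -> Dv v (newton_iter f (jacobian_x f) x0 v q) /\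
          X (cplx q) = cplx (newton_iter f (jacobian_x f) x0 v q)].
  by exists X; split=> // q /XE[].
elim: v => [|v [X [Xa XT XE]]].
  exists (fun=> cplx x0); split=> // [g _ i j|g _].
    exact: analytic_at_cst.
  by apply: Dv_Theta; exists x0.
have [_ _ fva fvE] := fv_ext v; have [_ _ Jva JvE] := Jv_ext v.
exists (fun g => newton_map (fv v) (Jv v) (X g) g); split.
- have [_ _ Po] := Psi_domain.
  exact: analytic_on_newton_map Po fva Jva (Jv_unit v) Xa XT.
- by move=> g Pg; apply: newton_Theta => //; exact: XT.
- move=> q Gq; have [Dx Xq] := XE q Gq; split; first exact: newton_Dv.
  set x := newton_iter _ _ _ _ _ in Dx Xq *.
  (* At this real point [fv v] and [Jv v] agree with [f] and its Jacobian, so the complex step is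
     the real one. *)
  have Sxq : prod_set (Dv v) (@cube R N) (col_mx x q).
    by rewrite /prod_set /= col_mxKu col_mxKd.
  rewrite Xq; apply: cplx_newton_map.
    by have := fvE _ Sxq; rewrite cplx_col_mx /joint !col_mxKu !col_mxKd.
  by have := JvE _ Sxq; rewrite cplx_col_mx /joint !col_mxKu !col_mxKd.
Qed.
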